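(* Let $A\colon X\to Y$ be a linear continuous mapping between two real locally convex topological vector spaces, and let $\Omega\subset X$ be a convex set such that $\operatorname{iri}(\Omega)\ne\emptyset$ and $A(\Omega)$ is quasi-regular. Then $$A\big(\operatorname{qri}(\Omega)\big)=\operatorname{qri}\big(A(\Omega)\big).$$
   Context: For a nonempty subset $B$ of a real locally convex topological vector space $Z$, $\operatorname{cone}(B):=\{tb\mid t\ge 0,\ b\in B\}$ and $\overline{\operatorname{cone}}(B)$ is its closure. For a nonempty convex set $C\subset Z$, the intrinsic relative interior is $\operatorname{iri}(C):=\{x\in C\mid \operatorname{cone}(C-x)\text{ is a linear subspace of }Z\}$ and the quasi-relative interior is $\operatorname{qri}(C):=\{x\in C\mid \overline{\operatorname{cone}}(C-x)\text{ is a linear subspace of }Z\}$; by convention $\operatorname{iri}(\emptyset)=\operatorname{qri}(\emptyset)=\emptyset$. A convex set $C$ is called quasi-regular if $\operatorname{qri}(C)=\operatorname{iri}(C)$. *)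

(* Defs.v *)
From HB Require Import structures.
From mathcomp Require Import all_boot all_order all_algebra.
From mathcomp Require Import all_classical all_reals all_analysis.

Set Implicit Arguments.
Unset Strict Implicit.
Unset Printing Implicit Defensive.

Import Order.TTheory GRing.Theory Num.Theory.

Local Open Scope classical_set_scope.
Local Open Scope ring_scope.

Definition cone (R : realType) (V : lmodType R) (B : set V) : set V :=
  [set v | exists t b, [/\ 0 <= t, B b & v = t *: b]].

Definition translate_by (R : realType) (V : lmodType R) (C : set V) (x : V) :
  set V := [set c - x | c in C].

Definition linear_subspace (R : realType) (V : lmodType R) (S : set V) : Prop :=
  submod_closed [in S].

(* The definitions below apply to an arbitrary set [C], but are meant for convex
   ones.  Since they require [x] to be in [C], both interiors of the empty set
   are empty, and [cone] is only ever applied to a nonempty set. *)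
Definition iri (R : realType) (V : lmodType R) (C : set V) : set V :=
  [set x | C x /\ linear_subspace (cone (translate_by C x))].

Definition qri (R : realType) (V : tvsType R) (C : set V) : set V :=
  [set x | C x /\ linear_subspace (closure (cone (translate_by C x)))].

Definition quasi_regular (R : realType) (V : tvsType R) (C : set V) : Prop :=
  convex_set C /\ qri C = iri C.

(* Main.v *)
(* Left to right: for K = cone (Omega - x), continuity gives
   closure (A K) = closure (A (closure K)), the closure of the linear image of a
   subspace.  Right to left: fix x0 in iri Omega and y in
   qri (A Omega) = iri (A Omega).  As cone (A Omega - y) is a subspace containing
   A x0 - y, there are t >= 0 and w in Omega with y - A x0 = t (A w - y), so y is
   the image of x = (x0 + t w) / (1 + t); and iri Omega contains the half-open
   segment [x0, w), hence x. *)
Require Import Defs.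
From HB Require Import structures.
From mathcomp Require Import all_boot all_order all_algebra.
From mathcomp Require Import all_classical all_reals all_analysis.

Import Order.TTheory GRing.Theory Num.Theory.

Local Open Scope classical_set_scope.
Local Open Scope ring_scope.

Lemma linear_subspaceP (R : realType) (V : lmodType R) (S : set V) :
  linear_subspace S <->
  S 0 /\ forall (a : R) u v, S u -> S v -> S (a *: u + v).
Proof.
split=> [[S0 SD]|[S0 SD]]; split.
- by move: S0; rewrite inE.
- by move=> a u v Su Sv; have := SD a u v; rewrite !inE; apply.
- by rewrite inE.
- by move=> a u v; rewrite !inE; exact: SD.
Qed.

Lemma linear_subspaceN (R : realType) (V : lmodType R) (S : set V) v :
  linear_subspace S -> S v -> S (- v).
Proof.
move=> /linear_subspaceP[S0 SD] Sv.
by rewrite -scaleN1r -[_ *: _]addr0; exact: SD.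
Qed.

(** The map [(u, v) |-> a *: u + v] is continuous, so any neighbourhood of its value contains the
    image of a product of neighbourhoods of [u] and [v], and each of these meets [S]. *)
Lemma linear_subspace_closure (R : realType) (V : tvsType R) (S : set V) :
  linear_subspace S -> linear_subspace (closure S).
Proof.
move=> /linear_subspaceP[S0 SD]; apply/linear_subspaceP; split.
  exact: subset_closure.
move=> a u v clu clv W.
have cont : (fun p : V * V => a *: p.1 + p.2) @ nbhs (u, v) --> a *: u + v.
  apply: (@continuous2_cvg _ V V V _ _ _ _ +%R); last exact: cvg_snd.
    exact: (add_continuous (a *: u, v)).
  apply: (@continuous2_cvg _ R^o V V _ _ _ _ *:%R).
  - exact: (scale_continuous ((a : R^o), u)).
  - exact: cvg_cst.
  - exact: cvg_fst.
move=> /cont[[B C] /= [Bu Cv]] BCW.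
have [x [Sx Bx]] := clu _ Bu; have [y [Sy Cy]] := clv _ Cv.
exists (a *: x + y); split; first exact: SD.
exact: (BCW (x, y)).
Qed.

Lemma linear_subspace_image (R : realType) (V W : lmodType R)
    (f : {linear V -> W}) (S : set V) :
  linear_subspace S -> linear_subspace (f @` S).
Proof.
move=> /linear_subspaceP[S0 SD]; apply/linear_subspaceP; split.
  by exists 0 => //; exact: linear0.
move=> a _ _ [u Su <-] [v Sv <-].
by exists (a *: u + v); [exact: SD|exact: linearP].
Qed.

Lemma image_closure (T U : topologicalType) (f : T -> U) (S : set T) :
  continuous f -> f @` closure S `<=` closure (f @` S).
Proof.
move=> cf _ [x clx <-] W /cf/clx[y [Sy Wy]].
by exists (f y); split => //; exists y.
Qed.

Lemma closure_image_closure (T U : topologicalType) (f : T -> U) (S : set T) :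
  continuous f -> closure (f @` closure S) = closure (f @` S).
Proof.
move=> cf; apply/seteqP; split; last first.
  exact/closure_subset/image_subset/subset_closure.
(* The right-hand closure is written as its own closure, so that monotonicity of [closure] reduces
   the goal to [image_closure]. *)
rewrite [X in _ `<=` X](iffLR (closure_id _) (@closed_closure _ _)).
exact/closure_subset/image_closure.
Qed.

Lemma iri_sub_qri (R : realType) (V : tvsType R) (C : set V) :
  iri C `<=` qri C.
Proof. by move=> x [Cx lin]; split=> //; exact: linear_subspace_closure. Qed.

Lemma cone_translateP (R : realType) (V : lmodType R) (C : set V) (x v : V) :
  cone (translate_by C x) v <->
  exists t c, [/\ 0 <= t, C c & v = t *: (c - x)].
Proof.
split=> [[t [_ [t0 [c Cc <-] ->]]]|[t [c [t0 Cc ->]]]]; first by exists t, c.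
by exists t, (c - x); split => //; exists c.
Qed.

Lemma image_cone_translate (R : realType) (V W : lmodType R)
    (f : {linear V -> W}) (C : set V) (x : V) :
  f @` cone (translate_by C x) = cone (translate_by (f @` C) (f x)).
Proof.
apply/seteqP; split=> [_ [v /cone_translateP[t [c [t0 Cc ->]]] <-]|w].
  apply/cone_translateP; exists t, (f c); rewrite linearZ linearB.
  by split=> //; exists c.
move=> /cone_translateP[t [_ [t0 [c Cc <-] ->]]].
exists (t *: (c - x)); last by rewrite linearZ linearB.
by apply/cone_translateP; exists t, c.
Qed.

Lemma convex_setP (R : realType) (V : lmodType R) (C : set V) (s t : R) x y :
  convex_set C -> 0 <= s -> 0 <= t -> s + t = 1 -> C x -> C y ->
  C (s *: x + t *: y).
Proof.
move=> convC s0 t0 st1 Cx Cy.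
have s1 : s <= 1 by rewrite -st1 lerDl.
have := convC x y (Itv01 s0 s1); rewrite !inE => /(_ Cx Cy).
by rewrite /conv /= /unstable.onem -{1}st1 addrAC subrr add0r.
Qed.

Lemma cone_translateZ (R : realType) (V : lmodType R) (C : set V) (x v : V)
    (a : R) : 0 <= a ->
  cone (translate_by C x) v -> cone (translate_by C x) (a *: v).
Proof.
move=> a0 /cone_translateP[t [c [t0 Cc ->]]]; apply/cone_translateP.
by exists (a * t), c; split; rewrite ?scalerA ?mulr_ge0.
Qed.

(** By convexity, [s *: (c - x) + t *: (d - x)] is [s + t] times [e - x], where [e] is the average
    of [c] and [d] with weights proportional to [s] and [t]. *)
Lemma cone_translateD (R : realType) (V : lmodType R) (C : set V) (x u v : V) :
  convex_set C -> cone (translate_by C x) u -> cone (translate_by C x) v ->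
  cone (translate_by C x) (u + v).
Proof.
move=> convC /cone_translateP[s [c [s0 Cc ->]]] /cone_translateP[t [d [t0 Cd ->]]].
apply/cone_translateP.
(* If [s + t = 0], the weights are undefined, but both summands vanish. *)
have [st0|st0] := eqVneq (s + t) 0.
  have /andP[/eqP -> /eqP ->] : (s == 0) && (t == 0).
    by rewrite -paddr_eq0// st0.
  by exists 0, c; rewrite !scale0r addr0.
exists (s + t), ((s / (s + t)) *: c + (t / (s + t)) *: d); split.
- exact: addr_ge0.
- apply: convex_setP => //; try by rewrite divr_ge0// addr_ge0.
  by rewrite -mulrDl divff.
rewrite [RHS]scalerBr [in RHS]scalerDr !scalerA !(mulrC (s + t)) !divfK//.
by rewrite !scalerBr scalerDl opprD addrACA.
Qed.

(** The cone of a convex set is already stable under sums and nonnegative scalings. Only opposites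
    are missing, and those of the generators [c - x] suffice. *)
Lemma linear_subspace_cone (R : realType) (V : lmodType R) (C : set V) (x : V) :
  convex_set C -> C x ->
  (forall c, C c -> cone (translate_by C x) (x - c)) ->
  linear_subspace (cone (translate_by C x)).
Proof.
move=> convC Cx sym; apply/linear_subspaceP; split.
  by apply/cone_translateP; exists 0, x; rewrite scale0r.
move=> a u v Ku Kv; apply: cone_translateD => //.
have [a0|/ltW a0] := leP 0 a; first exact: cone_translateZ.
(* For [a <= 0], [a *: u] is the nonnegative multiple [- a] of [- u]. *)
rewrite -[a]opprK scaleNr -scalerN; apply: cone_translateZ; rewrite ?oppr_ge0//.
have /cone_translateP[t [c [t0 Cc ->]]] := Ku.
by rewrite -scalerN opprB; apply: cone_translateZ => //; exact: sym.
Qed.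

(* The relation x - x0 = t (w - x) says x = (x0 + t w) / (1 + t), a point of the
   half-open segment [x0, w). *)
Lemma iri_segment (R : realType) (V : lmodType R) (C : set V) (x0 x w : V)
    (t : R) :
  convex_set C -> iri C x0 -> C x -> C w -> 0 <= t ->
  x - x0 = t *: (w - x) -> iri C x.
Proof.
move=> convC [Cx0 lin0] Cx Cw t0 xE; split=> //.
have Kx : cone (translate_by C x) (x - x0) by apply/cone_translateP; exists t, w.
apply: linear_subspace_cone => // c Cc.
have /(linear_subspaceN _)/cone_translateP[//|s [p [s0 Cp]]] :
  cone (translate_by C x0) (c - x0).
  by apply/cone_translateP; exists 1, c; rewrite scale1r.
rewrite opprB => cE.
(* Since [x0 - c = s *: (p - x0)], passing through [x0] and then splitting [p - x0] at [x] leaves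
   three terms, each in the cone at [x]. *)
have -> : x - c = (x - x0) + (s *: (p - x) + s *: (x - x0)).
  by rewrite -scalerDr subrKA -cE subrKA.
do 2 apply: cone_translateD => //; last exact: cone_translateZ.
by apply/cone_translateP; exists s, p.
Qed.

Theorem theorem5p1 (R : realType) (X Y : tvsType R) (A : {linear X -> Y})
    (Omega : set X) (hA : continuous A) (hOmega : convex_set Omega)
    (hiri : iri Omega !=set0) (hreg : quasi_regular (A @` Omega)) :
  A @` (qri Omega) = qri (A @` Omega).
Proof.
apply/seteqP; split=> [_ [x [Ox lin] <-]|y].
  split; first by exists x.
  rewrite -image_cone_translate -closure_image_closure//.
  exact/linear_subspace_closure/linear_subspace_image.
(* Quasi-regularity removes the closure: opposites now stay in the cone itself, so they are exact
   multiples of some [A w - y] and not mere limits of such. *)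
rewrite hreg.2 => -[Oy lin].
have [x0 x0iri] := hiri; have Ox0 := x0iri.1.
have : cone (translate_by (A @` Omega) y) (A x0 - y).
  apply/cone_translateP; exists 1, (A x0); rewrite scale1r.
  by split=> //; exists x0.
move=> /(linear_subspaceN _)-/(_ lin)/cone_translateP[t [_ [t0 [w Ow <-]]]].
rewrite opprB => yE.
have t1 : 0 < 1 + t by rewrite ltr_wpDr.
have t1n : 1 + t != 0 by rewrite gt_eqF.
have [x Ox xE] : exists2 x, Omega x & (1 + t) *: x = x0 + t *: w.
  exists ((1 + t)^-1 *: x0 + (t / (1 + t)) *: w).
    apply: convex_setP => //; rewrite ?invr_ge0 ?divr_ge0 ?(ltW t1)//.
    by rewrite -[X in X + _]mul1r -mulrDl divff.
  by rewrite scalerDr !scalerA divff// scale1r mulrCA divff// mulr1.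
exists x.
  (* The relation [x - x0 = t *: (w - x)] is a rearrangement of [xE]. *)
  apply/iri_sub_qri/(iri_segment _ _ _ x0 x w t) => //.
  apply/eqP; rewrite scalerBr subr_eq addrAC -(addrC x0) -xE.
  by rewrite scalerDl scale1r addrK.
have := congr1 A xE; rewrite linearD !linearZ => AxE.
(* Both [A x] and [y] become [A x0 + t *: A w] when multiplied by the nonzero scalar [1 + t]: the
   first by [xE], the second by [yE]. *)
apply: (scalerI t1n); rewrite AxE scalerDl scale1r.
by rewrite -{1}[y](subrK (A x0)) yE scalerBr [RHS]addrAC subrK addrC.
Qed.
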